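(* Let $N_1,N_2,\omega\in\mathbb{N}$, $\tau\in\mathbb{N}_0$. For $i\in\{1,\ldots,N_1\}$ and $j\in\{1,\ldots,N_2\}$ let $\hat c_i,\tilde c_j:\mathbb{N}_0\to(-1,1)$, $\hat a_{ij},\tilde a_{ji},\hat b_{ij},\tilde b_{ji},\hat I_i,\tilde I_j:\mathbb{N}_0\to\mathbb{R}$ and $\hat\tau_{ij},\tilde\tau_{ji}:\mathbb{N}_0\to\mathbb{N}_0$ be $\omega$-periodic functions, and let $f_j,g_i:\mathbb{R}\to\mathbb{R}$ be Lipschitz functions with Lipschitz constants $F_j$ and $G_i$, respectively. Consider the model $$\begin{cases}x_i(m+1)=\hat c_i(m)x_i(m-\tau)+\sum_{j=1}^{N_2}\hat a_{ij}(m)f_j(y_j(m))+\sum_{j=1}^{N_2}\hat b_{ij}(m)f_j(y_j(m-\hat\tau_{ij}(m)))+\hat I_i(m),& i=1,\ldots,N_1,\\[4pt] y_j(m+1)=\tilde c_j(m)y_j(m-\tau)+\sum_{i=1}^{N_1}\tilde a_{ji}(m)g_i(x_i(m))+\sum_{i=1}^{N_1}\tilde b_{ji}(m)g_i(x_i(m-\tilde\tau_{ji}(m)))+\tilde I_j(m),& j=1,\ldots,N_2,\end{cases}$$ for $m\in\mathbb{N}_0$. For each function $\phi$ among $\hat c_i,\tilde c_j,\hat a_{ij},\tilde a_{ji},\hat b_{ij},\tilde b_{ji}$ write $\phi^+=\sup_{m\in\mathbb{N}_0}|\phi(m)|$, and define $$\mathcal{P}=\begin{bmatrix}\mathcal{I}_{N_1}-\hat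 C&-U\\-S&\mathcal{I}_{N_2}-\tilde C\end{bmatrix},$$ where $\mathcal{I}_{N_k}$ is the $N_k\times N_k$ identity matrix ($k=1,2$), $\hat C=\mathrm{diag}(\hat c_1^+,\ldots,\hat c_{N_1}^+)$, $\tilde C=\mathrm{diag}(\tilde c_1^+,\ldots,\tilde c_{N_2}^+)$, $U$ is the $N_1\times N_2$ matrix with $(i,j)$ entry $(\hat a_{ij}^++\hat b_{ij}^+)F_j$, and $S$ is the $N_2\times N_1$ matrix with $(j,i)$ entry $(\tilde a_{ji}^++\tilde b_{ji}^+)G_i$. If $\mathcal{P}$ is a non-singular M-matrix, then the model has a unique $\omega$-periodic solution, and this solution is globally exponentially stable.
   Context: $\mathbb{N}=\{1,2,\ldots\}$, $\mathbb{N}_0=\mathbb{N}\cup\{0\}$. Put $N=N_1+N_2$ and $r=-\max_{i,j,m}\{\hat\tau_{ij}(m),\tilde\tau_{ji}(m),\tau\}$. For $I\subseteq\mathbb{R}$, $I_{\mathbb{Z}}=I\cap\mathbb{Z}$. $X$ is the space of functions $\alpha:[r,0]_{\mathbb{Z}}\to\mathbb{R}$ with norm $\|\alpha\|=\max_{l=r,\ldots,0}|\alpha(l)|$. $X^N$ carries the norm $\|\overline\alpha\|=\max_{i=1,\ldots,N}\|\alpha_i\|$. A solution is written $\overline{z}=(x_1,\ldots,x_{N_1},y_1,\ldots,y_{N_2}):[r,+\infty)_{\mathbb{Z}}\to\mathbb{R}^N$, and $\overline{z}_m\in X^N$ is defined by $\overline{z}_m(l)=\overline{z}(m+l)$, $l=r,\ldots,0$.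 For $\overline\alpha\in X^N$, $\overline{z}(\cdot,\overline\alpha)$ is the unique solution with $\overline{z}_0=\overline\alpha$, and $\overline{z}_m(\cdot,\overline\alpha)$ is its segment at time $m$. A function $g$ on $\mathbb{N}_0$ is $\omega$-periodic if $g(m+\omega)=g(m)$ for all $m\in\mathbb{N}_0$; an $\omega$-periodic solution is a solution $\overline{z}^*$ with $\overline{z}^*(m+\omega)=\overline{z}^*(m)$ for all integers $m\ge r$. A solution $\overline{z}^*$ is globally exponentially stable if there are $C>0$ and $\zeta\in(0,1)$ such that $\|\overline{z}_m(\cdot,\overline\alpha)-\overline{z}^*_m\|\le C\zeta^m\|\overline\alpha-\overline{z}^*_0\|$ for all $\overline\alpha\in X^N$ and $m\in\mathbb{N}_0$. A non-singular M-matrix is a real square matrix with non-positive off-diagonal entries all of whose eigenvalues have positive real part (equivalently, with all principal minors positive). *)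

(* Defs.v *)
From HB Require Import structures.
From mathcomp Require Import all_boot all_order all_algebra.
From mathcomp Require Import all_classical all_reals.
From mathcomp Require Import complex.

Set Implicit Arguments.
Unset Strict Implicit.
Unset Printing Implicit Defensive.

Import Order.TTheory GRing.Theory Num.Theory.
Local Open Scope classical_set_scope.
Local Open Scope ring_scope.

Definition periodic_nat (T : Type) (omega : nat) (g : nat -> T) : Prop :=
  forall m : nat, g (m + omega)%N = g m.

Definition nonsingular_M_matrix (R : realType) (n : nat) (A : 'M[R]_n) : Prop :=
  (forall i j : 'I_n, i != j -> A i j <= 0) /\
  (forall lambda : R[i],
     eigenvalue (map_mx (real_complex R) A) lambda ->
     0 < complex.Re lambda).

(* The phi^+ of the coefficient bounds; the set is bounded for the periodic phi considered. *)
Definition sup_abs (R : realType) (phi : nat -> R) : R :=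
  sup (range (fun m => `|phi m|)).

(* Naming: the suffixes h and t stand for hat and tilde; hat quantities
   govern the x-neurons (first layer), tilde ones the y-neurons. *)
Record bam (R : realType) (N1 N2 : nat) := Bam {
  tau : nat;
  ch : 'I_N1 -> nat -> R;
  ct : 'I_N2 -> nat -> R;
  ah : 'I_N1 -> 'I_N2 -> nat -> R;
  at_ : 'I_N2 -> 'I_N1 -> nat -> R;
  bh : 'I_N1 -> 'I_N2 -> nat -> R;
  bt : 'I_N2 -> 'I_N1 -> nat -> R;
  Ih : 'I_N1 -> nat -> R;
  It : 'I_N2 -> nat -> R;
  tauh : 'I_N1 -> 'I_N2 -> nat -> nat;
  taut : 'I_N2 -> 'I_N1 -> nat -> nat;
  f : 'I_N2 -> R -> R;
  g : 'I_N1 -> R -> R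
}.

Section Model.
Variables (R : realType) (N1 N2 : nat) (M : bam R N1 N2).

Definition bam_periodic (omega : nat) : Prop :=
  (forall i, periodic_nat omega (ch M i)) /\
  (forall j, periodic_nat omega (ct M j)) /\
  (forall i j, periodic_nat omega (ah M i j)) /\
  (forall j i, periodic_nat omega (at_ M j i)) /\
  (forall i j, periodic_nat omega (bh M i j)) /\
  (forall j i, periodic_nat omega (bt M j i)) /\
  (forall i, periodic_nat omega (Ih M i)) /\
  (forall j, periodic_nat omega (It M j)) /\
  (forall i j, periodic_nat omega (tauh M i j)) /\
  (forall j i, periodic_nat omega (taut M j i)).

Definition delays : set nat :=
  [set d | d = tau M \/ (exists i j m, d = tauh M i j m) \/
           (exists j i m, d = taut M j i m)].

(* The initial time r is - max_delay. For periodic delays the supremum is a maximum,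
   see max_delayP below. *)
Definition max_delay : nat := supremum 0%N delays.

(* A trajectory [r, +oo)_Z -> R^N is a total function on int of which only the
   values at times t >= - max_delay are ever used; two trajectories are the
   same when they agree there. *)
Definition trajectory := int -> 'rV[R]_(N1 + N2).

Definition same_trajectory (z z' : trajectory) : Prop :=
  forall t : int, - max_delay%:Z <= t -> z t = z' t.

Definition xc (z : trajectory) (i : 'I_N1) (t : int) : R := z t 0 (lshift N2 i).
Definition yc (z : trajectory) (j : 'I_N2) (t : int) : R := z t 0 (rshift N1 j).

Definition is_solution (z : trajectory) : Prop :=
  forall m : nat,
    (forall i : 'I_N1,
       xc z i m.+1%:Z =
         ch M i m * xc z i (m%:Z - (tau M)%:Z)
         + \sum_(j < N2) ah M i j m * f M j (yc z j m%:Z)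
         + \sum_(j < N2) bh M i j m * f M j (yc z j (m%:Z - (tauh M i j m)%:Z))
         + Ih M i m) /\
    (forall j : 'I_N2,
       yc z j m.+1%:Z =
         ct M j m * yc z j (m%:Z - (tau M)%:Z)
         + \sum_(i < N1) at_ M j i m * g M i (xc z i m%:Z)
         + \sum_(i < N1) bt M j i m * g M i (xc z i (m%:Z - (taut M j i m)%:Z))
         + It M j m).

Definition periodic_solution (omega : nat) (z : trajectory) : Prop :=
  is_solution z /\
  forall t : int, - max_delay%:Z <= t -> z (t + omega%:Z) = z t.

(* The spaces X and X^N: the index p of a history stands for the time
   l = - p, which ranges over [r, 0]_Z. *)
Definition history := {ffun 'I_max_delay.+1 -> R}.
Definition histories := {ffun 'I_(N1 + N2) -> history}.

Definition norm_history (alpha : history) : R :=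
  \big[Num.max/0]_(p < max_delay.+1) `|alpha p|.

Definition norm_histories (alpha : histories) : R :=
  \big[Num.max/0]_(i < N1 + N2) norm_history (alpha i).

Definition segment (z : trajectory) (m : nat) : histories :=
  [ffun i => [ffun p : 'I_max_delay.+1 => z (m%:Z - (p : nat)%:Z) 0 i]].

(* z below is the solution with initial history alpha; it exists and is unique
   by solution_exists_unique. *)
Definition globally_exponentially_stable (zs : trajectory) : Prop :=
  exists C zeta : R, 0 < C /\ 0 < zeta < 1 /\
    forall (alpha : histories) (z : trajectory),
      is_solution z -> segment z 0 = alpha ->
      forall m : nat,
        norm_histories (segment z m - segment zs m)
          <= C * zeta ^+ m * norm_histories (alpha - segment zs 0).

Definition P_matrix (F : 'I_N2 -> R) (G : 'I_N1 -> R) : 'M[R]_(N1 + N2) :=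
  let Chat := diag_mx (\row_i sup_abs (ch M i)) in
  let Ctilde := diag_mx (\row_j sup_abs (ct M j)) in
  let U := \matrix_(i < N1, j < N2)
             ((sup_abs (ah M i j) + sup_abs (bh M i j)) * F j) in
  let S := \matrix_(j < N2, i < N1)
             ((sup_abs (at_ M j i) + sup_abs (bt M j i)) * G i) in
  block_mx (1%:M - Chat) (- U) (- S) (1%:M - Ctilde).

Lemma periodic_nat_mod (T : Type) (omega : nat) (h : nat -> T) :
  periodic_nat omega h -> forall m, h m = h (m %% omega)%N.
Proof.
move=> hP m; rewrite {1}(divn_eq m omega).
elim: (m %/ omega)%N => [|k IH]; first by rewrite mul0n add0n.
by rewrite mulSn -addnA addnC hP.
Qed.

Lemma max_delayP (omega : nat) : (0 < omega)%N -> bam_periodic omega ->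
  delays max_delay /\ forall d, delays d -> (d <= max_delay)%N.
Proof.
move=> o0 [_ [_ [_ [_ [_ [_ [_ [_ [ph pt]]]]]]]]].
have hsup : supremums delays !=set0.
  apply: nat_supremums_neq0.
  exists (tau M + \sum_i \sum_j \sum_(m < omega) tauh M i j m
          + \sum_j \sum_i \sum_(m < omega) taut M j i m)%N.
  move=> d /= [->|[[i [j [m ->]]]|[j [i [m ->]]]]]; rewrite leEnat.
  - by rewrite -addnA leq_addr.
  - rewrite -addnA addnCA (periodic_nat_mod (ph i j)).
    rewrite (bigD1 i) //= (bigD1 j) //= (bigD1 (Ordinal (ltn_pmod m o0))) //=.
    by rewrite -!addnA leq_addr.
  - rewrite addnC (periodic_nat_mod (pt j i)).
    rewrite (bigD1 j) //= (bigD1 i) //= (bigD1 (Ordinal (ltn_pmod m o0))) //=.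
    by rewrite -!addnA leq_addr.
have ub d : delays d -> (d <= max_delay)%N.
  by move=> Dd; rewrite -leEnat; exact: ge_supremum_Nmem.
split=> //; apply: contrapT => nD.
have tD : delays (tau M) by left.
have : supremums delays max_delay.
  rewrite /max_delay /supremum; case: ifPn => [/eqP D0|_].
    by rewrite D0 in tD.
  by case: hsup => s hs; case: xgetP => // /(_ s).
case=> _ /(_ max_delay.-1) lub.
have dpos : (0 < max_delay)%N.
  by rewrite lt0n; apply/eqP => k0; apply: nD; move: (ub _ tD);
    rewrite k0 leqn0 => /eqP <-.
have : (max_delay <= max_delay.-1)%N.
  rewrite -leEnat; apply: lub => d Dd; rewrite leEnat -ltnS prednK //.
  rewrite ltn_neqAle ub // andbT; apply/eqP => e; apply: nD.
  by rewrite -e.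
by rewrite leqNgt ltn_predL dpos.
Qed.

Definition rhs (z : trajectory) (m : nat) : 'rV[R]_(N1 + N2) :=
  row_mx
    (\row_i (ch M i m * xc z i (m%:Z - (tau M)%:Z)
         + \sum_(j < N2) ah M i j m * f M j (yc z j m%:Z)
         + \sum_(j < N2) bh M i j m * f M j (yc z j (m%:Z - (tauh M i j m)%:Z))
         + Ih M i m))
    (\row_j (ct M j m * yc z j (m%:Z - (tau M)%:Z)
         + \sum_(i < N1) at_ M j i m * g M i (xc z i m%:Z)
         + \sum_(i < N1) bt M j i m * g M i (xc z i (m%:Z - (taut M j i m)%:Z))
         + It M j m)).

Lemma is_solutionE (z : trajectory) :
  is_solution z <-> forall m : nat, z m.+1%:Z = rhs z m.
Proof.
split=> [sz m|sz m].
- rewrite -[LHS]hsubmxK /rhs; have [hx hy] := sz m.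
  by congr row_mx; apply/rowP => i; rewrite !mxE; [exact: hx|exact: hy].
- by split=> i; rewrite ?/(xc z i m.+1) ?/(yc z i m.+1) sz /rhs
    ?row_mxEl ?row_mxEr mxE.
Qed.

Lemma rhs_ext (z z' : trajectory) (m : nat) :
  (forall d, delays d -> (d <= max_delay)%N) ->
  (forall t : int, - max_delay%:Z <= t <= m%:Z -> z t = z' t) ->
  rhs z m = rhs z' m.
Proof.
move=> ub zz'.
have e0 : z m%:Z = z' m%:Z.
  by apply: zz'; rewrite lexx andbT; apply: (@le_trans _ _ 0); rewrite ?oppr_le0.
have ed d : delays d -> z (m%:Z - d%:Z) = z' (m%:Z - d%:Z).
  move=> /ub dk; apply: zz'; apply/andP; split.
    by rewrite -[leLHS]add0r lerD // lerN2 lez_nat.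
  by rewrite gerBl.
rewrite /rhs /xc /yc; congr row_mx; apply/rowP => i; rewrite !mxE.
- rewrite e0 ed; last by left.
  congr (_ + _ + _); apply: eq_bigr => j _; rewrite ed //.
  by right; left; exists i, j, m.
- rewrite e0 ed; last by left.
  congr (_ + _ + _); apply: eq_bigr => j _; rewrite ed //.
  by right; right; exists i, j, m.
Qed.

Lemma solution_exists_unique (omega : nat) (alpha : histories) :
  (0 < omega)%N -> bam_periodic omega ->
  exists z : trajectory, is_solution z /\ segment z 0 = alpha /\
    forall z' : trajectory, is_solution z' -> segment z' 0 = alpha ->
      same_trajectory z' z.
Proof.
move=> o0 /(max_delayP o0)[_ ub].
pose z0 : trajectory := fun t =>
  \row_i (alpha i (inord `|t|%N)).
pose step (m : nat) (z : trajectory) : trajectory :=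
  fun t => if t == m.+1%:Z then rhs z m else z t.
pose Z := fix Z n := if n is m.+1 then step m (Z m) else z0.
pose z : trajectory := fun t => if t is Posz n then Z n n%:Z else z0 t.
have Zn n k (t : int) : t <= n%:Z -> Z (n + k)%N t = Z n t.
  move=> tn; elim: k => [|k IH]; first by rewrite addn0.
  rewrite addnS /= /step ifN ?IH // lt_eqF // (le_lt_trans tn) //.
  by rewrite ltz_nat ltnS leq_addr.
have zZ n (t : int) : t <= n%:Z -> z t = Z n t.
  case: t => [p pn|p _] /=.
    by rewrite lez_nat in pn; rewrite -(subnKC pn) Zn.
  by rewrite -[n]add0n Zn.
have seg0 (t : int) (i : 'I_(N1 + N2)) : - max_delay%:Z <= t <= 0 ->
    forall y : trajectory, segment y 0 = alpha ->
    y t 0 i = alpha i (inord `|t|%N).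
  move=> /andP[t1 t2] y <-; rewrite !ffunE inordK; first last.
    by rewrite ltnS -lez_nat abszE ler0_norm // lerNl.
  by rewrite abszE ler0_norm // sub0r opprK.
have solz : is_solution z.
  apply/is_solutionE => m; rewrite /= /step eqxx; apply: rhs_ext => // t.
  by move=> /andP[_ tm]; rewrite (zZ m).
have segz : segment z 0 = alpha.
  apply/ffunP => i; apply/ffunP => p; rewrite !ffunE (zZ 0%N) ?gerBl //=.
  rewrite /z0 mxE sub0r; congr (alpha i _); apply: val_inj.
  by rewrite abszN /= inordK //; exact: ltn_ord.
exists z; split=> //; split=> // z' solz' segz' t tk.
move/is_solutionE: solz' => solz'; move/is_solutionE: solz => solz.
suff H n : forall t : int, - max_delay%:Z <= t <= n%:Z -> z' t = z t.
  by apply: (H `|t|%N); rewrite tk abszE ler_norm.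
elim: n => [|n IH] {tk}t /andP[t1 t2].
  by apply/rowP => i; rewrite !(seg0 _ _ _ _ segz') ?(seg0 _ _ _ _ segz) ?t1.
move: t2; rewrite le_eqVlt => /predU1P[->|t2]; last first.
  by apply: IH; rewrite t1 /= -ltzD1 addrC -intS.
by rewrite solz solz'; exact: rhs_ext.
Qed.

End Model.

(* Main.v *)
Require Import Defs.
From mathcomp Require Import all_boot all_order all_algebra.
From mathcomp Require Import all_classical all_reals.
From mathcomp Require Import polyrcf complex zify ring lra.

(** A non-singular M-matrix [P] admits a vector [d] with positive entries such
    that [P d] is positive too ([M_matrix_positive_vector]).  Since the
    off-diagonal part of [P] collects the Lipschitz bounds of the couplings and
    its diagonal is [1 - c], this says that [1 - P], which dominates one step of
    the recursion, contracts the sup norm with weights [d] by a factor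
    [1 - e < 1] ([M_matrix_weights], [rhs_diff_le]).

    The delays spread this contraction over a window of length [k + 1], where
    [k] is the largest delay: if the difference of two solutions is bounded by
    [kappa * d] on such a window, then it is bounded by [(1 - e) * kappa * d] at
    the next time.  Hence any two solutions approach each other at a geometric
    rate [zeta] with [1 - e <= zeta ^+ k.+1] ([delayed_decay],
    [solutions_converge]).  This is exponential stability of every solution
    ([solution_stable]), and it leaves room for only one periodic solution
    ([periodic_solution_unique]).

    For existence, take any solution [z].  As the coefficients are periodic,
    [z (t + n * omega)] is a solution in [t] for each [n]; comparing the
    solutions for [n = 0] and [n = 1] shows that these translates form a Cauchy
    sequence with geometric rate, uniformly in [t].  The limit solves the
    equation and is periodic ([periodic_solution_exists]). *)

Set Implicit Arguments.
Unset Strict Implicit.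
Unset Printing Implicit Defensive.

Import Order.TTheory GRing.Theory Num.Theory.
Local Open Scope ring_scope.

(** * Positive vectors of M-matrices *)

(** Off the diagonal the entries are nonpositive, so replacing the other
    coordinates of [x] by the smallest one can only increase the value. *)
Lemma Zmatrix_row_min (R : realDomainType) (n : nat) (B : 'M[R]_n)
  (x : 'cV[R]_n) (i : 'I_n) :
  (forall j, i != j -> B i j <= 0) -> (forall j, x i 0 <= x j 0) ->
  (B *m x) i 0 <= x i 0 * \sum_j B i j.
Proof.
move=> Boff xmin; rewrite mxE mulr_sumr; apply: ler_sum => j _.
rewrite mulrC; have [<-//|ij] := eqVneq i j.
by apply: ler_wnM2r; [exact: Boff|exact: xmin].
Qed.

(** At a smallest coordinate [x i 0 <= 0], the bound of [Zmatrix_row_min] is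
    nonpositive in either case: a nonpositive number times a row sum that is
    nonnegative, or the coordinate itself is 0. *)
Lemma Zmatrix_solution_gt0 (R : realDomainType) (n : nat) (B : 'M[R]_n)
  (x : 'cV[R]_n) :
  (forall i j, i != j -> B i j <= 0) -> (forall i, 0 < (B *m x) i 0) ->
  (forall i, 0 <= \sum_j B i j) \/ (forall i, 0 <= x i 0) ->
  forall i, 0 < x i 0.
Proof.
move=> Boff Bx H i.
case: (arg_minP (fun j => x j 0) (erefl true : xpredT i)) => i0 _ imin.
apply: lt_le_trans (imin i erefl); rewrite ltNge; apply/negP => xi0.
have := Bx i0; rewrite ltNge => /negP; apply.
have row := Zmatrix_row_min (Boff i0) (fun j => imin j erefl).
apply: le_trans row _; case: H => [s0|x0]; first exact: mulr_le0_ge0.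
by have /eqP -> : x i0 0 == 0; [rewrite eq_le xi0 x0|rewrite mul0r].
Qed.

Lemma last_root (R : rcfType) (p : {poly R}) (t : R) : p != 0 -> root p t ->
  exists2 t0, t <= t0 & root p t0 /\ forall s, t0 < s -> ~~ root p s.
Proof.
move=> p0 pt; pose t0 := \big[Order.max/t]_(x <- rootsR p) x.
have rP x : root p x = (x \in rootsR p).
  by rewrite -(roots_on_rootsR p0) in_itv.
exists t0; first exact: bigmax_ge_id.
split.
  rewrite /t0 big_seq; elim/big_ind: _ => // [x y px py|x].
    by rewrite maxEle; case: ifP.
  by rewrite rP.
move=> s; rewrite rP; apply: contraTN => sr; rewrite -leNgt.
exact: (le_bigmax_seq t s xpredT id sr isT).
Qed.

Lemma root_of_nonpos (R : rcfType) (p : {poly R}) (a b : R) :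
  a <= b -> p.[a] <= 0 -> 0 < p.[b] -> exists2 x, a <= x & root p x.
Proof.
move=> ab pa pb; have [x /andP[ax _] px] : exists2 x, a <= x <= b & root p x.
  by apply: poly_ivt; rewrite // pa ltW.
by exists x.
Qed.

(** For [t >= 0] the vector [d t = adj(A + t I) 1] satisfies [(A + t I) (d t) = det(A + t I) 1], and the
    determinant, a monic polynomial in [t] whose nonnegative roots would be
    opposites of eigenvalues of [A], is positive.  The coordinates of [d t] are
    polynomials in [t], positive for large [t]; at the last [t >= 0] where one
    of them vanishes, all of them would be nonnegative, hence positive by
    [Zmatrix_solution_gt0].  So none ever vanishes, and [d 0] is the vector
    wanted. *)
Lemma M_matrix_positive_vector (R : realType) (n : nat) (A : 'M[R]_n) :
  nonsingular_M_matrix A ->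
  exists d : 'cV[R]_n, forall i, 0 < d i 0 /\ 0 < (A *m d) i 0.
Proof.
move=> [Aoff Aspec].
pose p := char_poly (- A).
pose q : 'cV[{poly R}]_n := \adj (char_poly_mx (- A)) *m const_mx 1.
pose d t : 'cV[R]_n := \col_i (q i 0).[t].
have dE t : (A + t%:M) *m d t = const_mx p.[t].
  have -> : d t = map_mx (horner_eval t) q.
    by apply/colP => i; rewrite !mxE.
  have -> : A + t%:M = map_mx (horner_eval t) (char_poly_mx (- A)).
    apply/matrixP => i j; rewrite !mxE /horner_eval !hornerE hornerMn hornerX.
    by rewrite opprK addrC.
  rewrite -map_mxM mulmxA mul_mx_adj mul_scalar_mx; apply/colP => i.
  by rewrite !mxE mulr1.
have shift_off t i j : i != j -> (A + t%:M) i j <= 0.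
  by move=> ij; rewrite !mxE (negbTE ij) addr0 Aoff.
have p_noroot t : 0 <= t -> ~~ root p t.
  move=> t0; apply/negP; rewrite -eigenvalue_root_char => /eigenvalueP[v vA v0].
  have : eigenvalue A (- t).
    by apply/eigenvalueP; exists v; rewrite // scaleNr -vA mulmxN opprK.
  rewrite -(eigenvalue_map (real_complex R)) => /Aspec /=.
  by rewrite oppr_gt0 ltNge t0.
have p_gt0 t : 0 <= t -> 0 < p.[t].
  move=> t0; rewrite -sgr_cp0; apply/eqP.
  have /(_ t) -> : {in `[0, +oo[, forall y, Num.sg p.[y] = sgp_pinfty p}.
  - apply: sgp_pinftyP => y; rewrite in_itv /= andbT; exact: p_noroot.
  - by rewrite /sgp_pinfty (monicP (char_poly_monic _)) sgr1.
  - by rewrite in_itv /= t0.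
have d_gt0 t : 0 <= t ->
    (forall i, 0 <= \sum_j (A + t%:M) i j) \/ (forall i, 0 <= d t i 0) ->
    forall i, 0 < d t i 0.
  move=> t0; apply: Zmatrix_solution_gt0; first exact: shift_off.
  by move=> i; rewrite dE mxE p_gt0.
(* Beyond T every row sum of A + t I is nonnegative. *)
pose T := \sum_i `|\sum_j A i j|.
have T0 : 0 <= T by apply: sumr_ge0.
have d_gt0_large t : T <= t -> forall i, 0 < d t i 0.
  move=> Tt; apply: d_gt0; first exact: le_trans Tt.
  left=> i; under eq_bigr do rewrite mxE; rewrite big_split /=.
  have -> : \sum_j (t%:M : 'M[R]_n) i j = t.
    rewrite (bigD1 i) //= mxE eqxx big1 ?addr0 // => j ji.
    by rewrite mxE eq_sym (negbTE ji).
  rewrite -lerBlDl sub0r; apply: le_trans Tt.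
  apply: (@le_trans _ _ `|\sum_j A i j|); last first.
    by rewrite /T [leRHS](bigD1 i) //= lerDl sumr_ge0.
  by rewrite -normrN; exact: ler_norm.
(* The roots of Q are the times at which some coordinate of d vanishes. *)
pose Q := \prod_i q i 0.
have rQ t : root Q t = [exists i, root (q i 0) t].
  rewrite rootE /Q horner_prod; apply/prodf_eq0/existsP => [[i _ ri]|[i ri]].
    by exists i.
  by exists i.
have Qnz : Q != 0.
  apply/prodf_neq0 => i _; apply/eqP => qi.
  by have := d_gt0_large T (lexx _) i; rewrite mxE qi horner0 ltxx.
have noroot t : 0 <= t -> ~~ root Q t.
  move=> t0; apply/negP => /(last_root Qnz)[s ts [Qs smax]].
  have s0 : 0 <= s by apply: le_trans ts.
  have ds_ge0 i : 0 <= d s i 0.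
    rewrite leNgt; apply/negP => dneg.
    have sm : s <= s + T by rewrite lerDl.
    have [x sx rx] : exists2 x, s <= x & root (q i 0) x.
      apply: root_of_nonpos sm _ _; first by rewrite ltW //; rewrite mxE in dneg.
      by have := d_gt0_large (s + T) _ i; rewrite mxE; apply; rewrite lerDr.
    have : s < x.
      rewrite lt_neqAle sx andbT; apply: contraTneq dneg => ->.
      by rewrite mxE (rootP rx) ltxx.
    by move/smax; rewrite rQ => /existsP; apply; exists i.
  move: Qs; rewrite rQ => /existsP[i /rootP qi].
  have /(_ i) : forall i, 0 < d s i 0 by apply: d_gt0 => //; right.
  by rewrite mxE qi ltxx.
exists (d 0) => i; split; last first.
  by have := dE 0; rewrite -scalemx1 scale0r addr0 => ->; rewrite mxE p_gt0.
rewrite ltNge; apply/negP; rewrite mxE => di.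
have [x x0 rx] : exists2 x, 0 <= x & root (q i 0) x.
  apply: root_of_nonpos T0 di _.
  by have := d_gt0_large T (lexx _) i; rewrite mxE.
by have := noroot x x0; rewrite rQ => /existsP; apply; exists i.
Qed.

(** The bound [e < 1] is there to let [1 - e] serve as a contraction factor. *)
Lemma positive_lower_bound (R : realFieldType) (I : finType) (u : I -> R) :
  (forall i, 0 < u i) -> exists2 e, 0 < e < 1 & forall i, e <= u i.
Proof.
move=> u0; exists (\big[Order.min/2^-1]_i u i); last by move=> i; exact: bigmin_le.
apply/andP; split.
  elim/big_ind: _ => // [|x y]; first lra.
  by rewrite lt_min => -> ->.
by apply: le_lt_trans (bigmin_le_id _ _ _ _) _; lra.
Qed.

(** The factor [1 - e] makes [A d > 0] uniform: [(1 - A) d <= (1 - e) d] says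
    that [1 - A] contracts the sup norm with weights [d].  Scaling [d] above 1
    makes that weighted norm at most the plain one. *)
Lemma M_matrix_weights (R : realType) (n : nat) (A : 'M[R]_n) :
  nonsingular_M_matrix A ->
  exists (d : 'cV[R]_n) (e : R), [/\ 0 < e < 1, forall i, 1 <= d i 0 &
    forall i, d i 0 - (A *m d) i 0 <= (1 - e) * d i 0].
Proof.
move=> /M_matrix_positive_vector[d0 d0P].
have [|delta /andP[delta0 _] deltaP] := @positive_lower_bound R _ (fun i => d0 i 0).
  by move=> i; have [] := d0P i.
have [|e e01 eP] := @positive_lower_bound R _ (fun i => (A *m d0) i 0 / d0 i 0).
  by move=> i; have [d0i Ad0i] := d0P i; rewrite divr_gt0.
exists (delta^-1 *: d0), e; split=> // i; rewrite -?scalemxAr !mxE.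
  by rewrite mulrC ler_pdivlMr // mul1r.
have [d0i _] := d0P i; have := eP i; rewrite ler_pdivlMr // mxE => ed.
rewrite mulrBl mul1r lerD2l lerN2 mulrCA ler_pM2l // invr_gt0 //.
Qed.

(** * Geometric sequences *)

Lemma bernoulli_inequality (R : realFieldType) (h : R) (n : nat) :
  -1 <= h -> 1 + n%:R * h <= (1 + h) ^+ n.
Proof.
move=> h1; elim: n => [|n IH]; first by rewrite mul0r addr0 expr0.
have h0 : 0 <= 1 + h by lra.
rewrite exprS; apply: le_trans (ler_wpM2l h0 IH).
have : 0 <= n%:R * h ^+ 2 by rewrite mulr_ge0 ?sqr_ge0.
rewrite -[n.+1]addn1 natrD; nra.
Qed.

Lemma geometric_bound_eq0 (R : realType) (B q x : R) : 0 < q < 1 ->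
  (forall n, `|x| <= B * q ^+ n) -> x = 0.
Proof.
move=> /andP[q0 q1] H; apply/eqP; rewrite -normr_le0 leNgt; apply/negP => x0.
(* B dominates |x| (1 + h)^n, hence |x| (1 + n h) by Bernoulli's inequality. *)
pose h := q^-1 - 1.
have h0 : 0 < h by rewrite subr_gt0 invf_gt1.
have xh0 : 0 < `|x| * h by rewrite mulr_gt0.
have B0 : 0 <= B by have := H 0%N; rewrite expr0 mulr1; apply: le_trans.
pose n := Num.bound (B / (`|x| * h)).
have : B / (`|x| * h) < n%:R by apply: archi_boundP; rewrite divr_ge0 // ltW.
rewrite ltr_pdivrMr // => Bn.
have xB : `|x| * (1 + h) ^+ n <= B.
  have -> : B = B * q ^+ n * (1 + h) ^+ n.
    by rewrite -mulrA -exprMn /h addrC subrK mulfV ?expr1n ?mulr1 // gt_eqF.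
  by apply: ler_wpM2r; rewrite // exprn_ge0 // addr_ge0 // ltW.
have h1 : -1 <= h by lra.
have := ler_wpM2l (ltW x0) (bernoulli_inequality n h1).
move: Bn xB x0; clear; nra.
Qed.

(** The intervals centred at [u n] with radius [B * q ^+ n] are nested, so all
    of them contain the supremum of their left ends. *)
Lemma geometric_limit (R : realType) (u : nat -> R) (B q : R) :
  0 <= B -> 0 <= q <= 1 ->
  (forall n, `|u n.+1 - u n| <= B * (q ^+ n - q ^+ n.+1)) ->
  exists l, forall n, `|u n - l| <= B * q ^+ n.
Proof.
move=> B0 /andP[q0 q1] H.
pose v n := u n - B * q ^+ n; pose w n := u n + B * q ^+ n.
have vmono : {homo v : m n / (m <= n)%N >-> m <= n}.
  apply: homo_leq => // [x|n]; first exact: le_trans.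
  by have := H n; rewrite ler_norml /v => /andP[]; lra.
have wmono : {homo w : m n / (m <= n)%N >-> n <= m}.
  apply: (homo_leq (r := fun x y => y <= x)) => // [y x z yx zy|n].
    exact: le_trans yx.
  by have := H n; rewrite ler_norml /w => /andP[]; lra.
have vw m n : v m <= w n.
  apply: (@le_trans _ _ (v (maxn m n))); first exact/vmono/leq_maxl.
  apply: (@le_trans _ _ (w (maxn m n))); last exact/wmono/leq_maxr.
  rewrite /v /w; have := exprn_ge0 (maxn m n) q0; nra.
exists (sup (range v)) => n; rewrite ler_distlC.
apply/andP; split.
  apply: ub_le_sup; last by exists n.
  by exists (w 0%N) => _ [m _ <-]; exact: vw.
by apply: ge_sup => [|_ [m _ <-]]; [exists (v 0%N); exists 0%N|exact: vw].
Qed.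

(** A discrete Halanay inequality.  The value at time [m + k + 1] is controlled
    by a factor [theta] times a common bound on the window of length [k + 1]
    before it; over that window a rate [zeta] loses at most [zeta ^+ k.+1], so
    [theta <= zeta ^+ k.+1] lets the geometric bound propagate. *)
Lemma delayed_decay (R : realFieldType) (I : Type) (k : nat) (d : I -> R)
  (theta zeta L : R) (w : nat -> I -> R) :
  (forall i, 0 <= d i) -> 0 <= L -> 0 <= zeta <= 1 -> theta <= zeta ^+ k.+1 ->
  (forall m (kappa : R), 0 <= kappa ->
    (forall s i, (m <= s <= m + k)%N -> `|w s i| <= kappa * d i) ->
    forall i, `|w (m + k).+1 i| <= kappa * (theta * d i)) ->
  (forall s i, (s <= k)%N -> `|w s i| <= L * zeta ^+ k * d i) ->
  forall s i, `|w s i| <= L * zeta ^+ s * d i.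
Proof.
move=> d0 L0 /andP[z0 z1] tz step init s; elim/ltn_ind: s => s IH i.
have [sk|ks] := leqP s k.
  apply: le_trans (init s i sk) _; apply: ler_wpM2r => //.
  by apply: ler_wpM2l => //; exact: ler_wiXn2l.
pose m := (s - k.+1)%N; have sE : s = (m + k).+1 by rewrite -addnS subnK.
have Lz j : 0 <= L * zeta ^+ j by rewrite mulr_ge0 // exprn_ge0.
rewrite sE; apply: le_trans (step m (L * zeta ^+ m) (Lz m) _ i) _.
  move=> r j /andP[mr rk]; apply: le_trans (IH r _ j) _; first by rewrite sE ltnS.
  by apply: ler_wpM2r => //; apply: ler_wpM2l => //; exact: ler_wiXn2l.
rewrite -addnS exprD -!mulrA; apply: ler_wpM2l => //.
by apply: ler_wpM2l; rewrite ?exprn_ge0 //; apply: ler_wpM2r.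
Qed.

(** * Comparison of two solutions *)

Lemma le_sup_abs (R : realType) (omega : nat) (phi : nat -> R) (m : nat) :
  (0 < omega)%N -> periodic_nat omega phi -> `|phi m| <= sup_abs phi.
Proof.
move=> o0 phiP; apply: ub_le_sup; last by exists m.
exists (\sum_(r < omega) `|phi r|) => _ [r _ <-].
rewrite (periodic_nat_mod phiP r) (bigD1 (Ordinal (ltn_pmod r o0))) //=.
by rewrite lerDl sumr_ge0.
Qed.

(** Both families of equations have this shape, so the estimate is made once
    for a single neuron fed by the neurons of the other layer. *)
Lemma neuron_diff_le (R : realDomainType) (n : nat) (c cp u u' D I kappa : R)
  (a ap b bp L v v' w w' E : 'I_n -> R) (h : 'I_n -> R -> R) :
  (forall j x y, `|h j x - h j y| <= L j * `|x - y|) ->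
  `|c| <= cp -> (forall j, `|a j| <= ap j) -> (forall j, `|b j| <= bp j) ->
  `|u - u'| <= kappa * D -> (forall j, `|v j - v' j| <= kappa * E j) ->
  (forall j, `|w j - w' j| <= kappa * E j) ->
  `|(c * u + \sum_j a j * h j (v j) + \sum_j b j * h j (w j) + I)
    - (c * u' + \sum_j a j * h j (v' j) + \sum_j b j * h j (w' j) + I)|
  <= kappa * (cp * D + \sum_j (ap j + bp j) * L j * E j).
Proof.
move=> hL hc ha hb hu hv hw.
have L0 j : 0 <= L j by have := hL j 1 0; rewrite subr0 normr1 mulr1; apply: le_trans.
have term (p q x y : R) j : `|p| <= q -> `|x - y| <= kappa * E j ->
    `|p * h j x - p * h j y| <= kappa * (q * L j * E j).
  move=> pq xy; rewrite -mulrBr normrM.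
  have -> : kappa * (q * L j * E j) = q * (L j * (kappa * E j)) by ring.
  apply: ler_pM => //; apply: le_trans (hL j x y) _; exact: ler_wpM2l.
set X := (X in `|X| <= _).
have -> : X = c * (u - u') + \sum_j (a j * h j (v j) - a j * h j (v' j))
    + \sum_j (b j * h j (w j) - b j * h j (w' j)) by rewrite /X !sumrB; ring.
rewrite [leRHS]mulrDr mulr_sumr.
under [X in _ <= _ + X]eq_bigr do rewrite !mulrDl mulrDr.
rewrite [in leRHS]big_split /= [leRHS]addrA.
apply: (le_trans (ler_normD _ _)); apply: lerD; last first.
  by apply: (le_trans (ler_norm_sum _ _ _)); apply: ler_sum => j _; apply: term.
apply: (le_trans (ler_normD _ _)); apply: lerD; last first.
  by apply: (le_trans (ler_norm_sum _ _ _)); apply: ler_sum => j _; apply: term.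
by rewrite normrM [leRHS]mulrCA; exact: ler_pM.
Qed.

Section BamModel.
Variables (R : realType) (N1 N2 omega : nat) (M : bam R N1 N2).
Variables (F : 'I_N2 -> R) (G : 'I_N1 -> R).
Hypotheses (omega_gt0 : (0 < omega)%N) (Mper : bam_periodic M omega).
Hypothesis f_lip : forall j u v, `|f M j u - f M j v| <= F j * `|u - v|.
Hypothesis g_lip : forall i u v, `|g M i u - g M i v| <= G i * `|u - v|.

Local Notation k := (max_delay M).
Local Notation P := (P_matrix M F G).

Lemma P_matrix_x (d : 'cV[R]_(N1 + N2)) (i : 'I_N1) :
  d (lshift N2 i) 0 - (P *m d) (lshift N2 i) 0 =
    sup_abs (ch M i) * d (lshift N2 i) 0
    + \sum_j (sup_abs (ah M i j) + sup_abs (bh M i j)) * F j * d (rshift N1 j) 0.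
Proof.
rewrite -[d in P *m d]vsubmxK mul_block_col col_mxEu mulmxBl mul1mx mul_diag_mx.
rewrite mulNmx !mxE; under eq_bigr do rewrite !mxE.
ring.
Qed.

Lemma P_matrix_y (d : 'cV[R]_(N1 + N2)) (j : 'I_N2) :
  d (rshift N1 j) 0 - (P *m d) (rshift N1 j) 0 =
    sup_abs (ct M j) * d (rshift N1 j) 0
    + \sum_i (sup_abs (at_ M j i) + sup_abs (bt M j i)) * G i * d (lshift N2 i) 0.
Proof.
rewrite -[d in P *m d]vsubmxK mul_block_col col_mxEd mulmxBl mul1mx mul_diag_mx.
rewrite mulNmx !mxE; under eq_bigr do rewrite !mxE.
ring.
Qed.

(** Read through [P_matrix_x] and [P_matrix_y], one step of the recursion is
    dominated, in the weights [d], by the nonnegative matrix [1 - P]. *)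
Lemma rhs_diff_le (d : 'cV[R]_(N1 + N2)) (kappa : R) (z z' : trajectory R N1 N2)
  (m : nat) :
  (forall t i, m%:Z - k%:Z <= t <= m%:Z ->
     `|z t 0 i - z' t 0 i| <= kappa * d i 0) ->
  forall i, `|rhs M z m 0 i - rhs M z' m 0 i| <= kappa * (d i 0 - (P *m d) i 0).
Proof.
move=> close; have [_ ub] := max_delayP omega_gt0 Mper.
have [pch [pct [pah [pat [pbh [pbt [_ [_ [_ _]]]]]]]]] := Mper.
have now i : `|z m%:Z 0 i - z' m%:Z 0 i| <= kappa * d i 0.
  by apply: close; rewrite lexx andbT gerBl.
have past e i : delays M e ->
    `|z (m%:Z - e%:Z) 0 i - z' (m%:Z - e%:Z) 0 i| <= kappa * d i 0.
  by move=> /ub ek; apply: close; rewrite gerBl andbT lerD2l lerN2 lez_nat.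
have del_tau : delays M (tau M) by left.
have del_tauh i j : delays M (tauh M i j m) by right; left; exists i, j, m.
have del_taut j i : delays M (taut M j i m) by right; right; exists j, i, m.
pose bound := le_sup_abs m omega_gt0.
move=> i; case: (splitP i) => [a ia|b ib].
  have -> : i = lshift N2 a by apply: val_inj.
  rewrite P_matrix_x /rhs !row_mxEl 2!mxE.
  apply: neuron_diff_le => [|||||j|j].
  - exact: f_lip.
  - exact: bound.
  - by move=> j; exact: bound.
  - by move=> j; exact: bound.
  - exact: past.
  - exact: now.
  - exact: past.
have -> : i = rshift N1 b by apply: val_inj.
rewrite P_matrix_y /rhs !row_mxEr 2!mxE.
apply: neuron_diff_le => [|||||j|j].
- exact: g_lip.
- exact: bound.
- by move=> j; exact: bound.
- by move=> j; exact: bound.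
- exact: past.
- exact: now.
- exact: past.
Qed.

Lemma coord_le_norm (z z' : trajectory R N1 N2) (t : int) i :
  - k%:Z <= t <= 0 ->
  `|z t 0 i - z' t 0 i| <= norm_histories (segment M z 0 - segment M z' 0).
Proof.
move=> /andP[kt t0]; have tk : (`|t| < k.+1)%N by lia.
apply: (le_trans _ (le_bigmax _ _ i)).
apply: (le_trans _ (le_bigmax _ _ (Ordinal tk))).
by rewrite !ffunE /= [0%:Z - _](_ : _ = t) //; lia.
Qed.

(** Time is counted from the start of the initial history: the index [s]
    stands for the time [s - k].  With [e] from [M_matrix_weights], Bernoulli's inequality shows that
    [zeta = 1 - e / (k + 1)] is a rate admissible in [delayed_decay]. *)
Lemma solutions_converge :
  nonsingular_M_matrix P ->
  exists C zeta : R, [/\ 0 < C, 0 < zeta < 1 &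
    forall z z' : trajectory R N1 N2, is_solution M z -> is_solution M z' ->
    forall (s : nat) i,
      `|z (s%:Z - k%:Z) 0 i - z' (s%:Z - k%:Z) 0 i|
        <= C * zeta ^+ s * norm_histories (segment M z 0 - segment M z' 0)].
Proof.
move=> /M_matrix_weights[d [e [/andP[e0 e1] d1 dP]]].
pose zeta := 1 - e / k.+1%:R; pose D := \big[Order.max/1]_i d i 0.
have k0 : 0 < k.+1%:R :> R by rewrite ltr0n.
have ek0 : 0 < e / k.+1%:R by rewrite divr_gt0.
have ek1 : e / k.+1%:R < 1.
  by rewrite ltr_pdivrMr // mul1r (lt_le_trans e1) // ler1n.
have zeta0 : 0 < zeta by rewrite subr_gt0.
have zeta1 : zeta < 1 by rewrite ltrBlDr ltrDl.
have ezeta : 1 - e <= zeta ^+ k.+1.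
  have := @bernoulli_inequality R (- (e / k.+1%:R)) k.+1.
  by rewrite mulrN mulrCA divff ?gt_eqF // mulr1; apply; rewrite lerN2 ltW.
have zk0 : 0 < zeta ^+ k by rewrite exprn_gt0.
have D1 : 1 <= D by exact: bigmax_ge_id.
exists (D / zeta ^+ k), zeta; split; [|by rewrite zeta0|].
  by rewrite divr_gt0 // (lt_le_trans _ D1).
move=> z z' /is_solutionE solz /is_solutionE solz' s i.
set N0 := norm_histories _; have N00 : 0 <= N0 by exact: bigmax_ge_id.
have d0 j : 0 <= d j 0 by apply: le_trans (d1 j).
pose L := N0 / zeta ^+ k; have L0 : 0 <= L by rewrite divr_ge0 // ltW.
pose w (r : nat) j := z (r%:Z - k%:Z) 0 j - z' (r%:Z - k%:Z) 0 j.
have wP : `|w s i| <= L * zeta ^+ s * d i 0.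
  apply: (@delayed_decay _ _ k (fun j => d j 0) (1 - e) zeta L w) => //.
  - by rewrite !ltW.
  - move=> m kappa kappa0 wm j; rewrite /w.
    have -> : (m + k).+1%:Z - k%:Z = m.+1%:Z by clear; lia.
    rewrite solz solz'; apply: le_trans (rhs_diff_le (d := d) (kappa := kappa) _ j) _.
      move=> t l tm; have := wm (absz (t + k%:Z)) l; rewrite /w.
      have -> : (absz (t + k%:Z))%:Z - k%:Z = t by clear -tm; lia.
      by apply; clear -tm; lia.
    exact: ler_wpM2l.
  - move=> r j rk; rewrite /L divfK ?gt_eqF //.
    apply: (@le_trans _ _ N0); first by apply: coord_le_norm; clear -rk; lia.
    by rewrite ler_peMr.
apply: le_trans wP _; rewrite /L.
have -> : D / zeta ^+ k * zeta ^+ s * N0 = N0 / zeta ^+ k * zeta ^+ s * D by ring.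
apply: ler_wpM2l; last exact: (le_bigmax 1 (fun i => d i 0) i).
by rewrite mulr_ge0 // exprn_ge0 // ltW.
Qed.

(** * The periodic solution *)

Lemma shift_solution (p : nat) (z : trajectory R N1 N2) :
  bam_periodic M p -> is_solution M z -> is_solution M (fun t => z (t + p%:Z)).
Proof.
move=> [pch [pct [pah [pat [pbh [pbt [pIh [pIt [ptauh ptaut]]]]]]]]].
move=> /is_solutionE solz; apply/is_solutionE => m.
have -> : m.+1%:Z + p%:Z = (m + p).+1%:Z by lia.
rewrite solz /rhs /xc /yc.
have e (n : nat) : (m + p)%:Z - n%:Z = m%:Z - n%:Z + p%:Z by lia.
congr row_mx; apply/rowP => i; rewrite !mxE !e.
- rewrite pch pIh; congr (_ + _ + _ + _); apply: eq_bigr => j _.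
    by rewrite pah PoszD.
  by rewrite pbh ptauh e.
- rewrite pct pIt; congr (_ + _ + _ + _); apply: eq_bigr => j _.
    by rewrite pat PoszD.
  by rewrite pbt ptaut e.
Qed.

Lemma bam_periodicM (n : nat) : bam_periodic M (n * omega).
Proof.
have per T (h : nat -> T) : periodic_nat omega h -> periodic_nat (n * omega) h.
  move=> hP m; elim: n => [|r IH]; first by rewrite addn0.
  by rewrite mulSn addnCA addnC hP.
have [pch [pct [pah [pat [pbh [pbt [pIh [pIt [ptauh ptaut]]]]]]]]] := Mper.
by do !split=> *; apply: per.
Qed.

(** Translates of a solution by multiples of the period are solutions, and two
    successive ones differ by [O(q ^+ n)] with [q = zeta ^+ omega], uniformly in
    time.  Their limit is again a solution because [rhs] is Lipschitz, and it is
    periodic because translating by one more period only shifts the sequence of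
    translates. *)
Lemma periodic_solution_exists :
  nonsingular_M_matrix P -> exists zs, periodic_solution M omega zs.
Proof.
move=> PM; have [C [zeta [C0 /andP[zeta0 zeta1] conv]]] := solutions_converge PM.
(* The weights d >= 1 turn the uniform bound B q^n into the weighted one that
   rhs_diff_le expects. *)
have [d [e [_ d1 _]]] := M_matrix_weights PM.
have [z [solz _]] := solution_exists_unique 0 omega_gt0 Mper.
pose q := zeta ^+ omega; pose y (n : nat) t := z (t + (n * omega)%N%:Z).
have soly n : is_solution M (y n) by apply: shift_solution => //; exact: bam_periodicM.
have q0 : 0 < q by rewrite exprn_gt0.
have q1 : q < 1 by rewrite exprn_ilt1 ?ltW // -lt0n.
pose N0 := norm_histories (segment M (y 1%N) 0 - segment M (y 0%N) 0).
(* B is such that B (q^n - q^(n+1)) bounds the n-th increment C N0 q^n. *)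
pose B := C * N0 / (1 - q).
have B0 : 0 <= B.
  by rewrite divr_ge0 ?subr_ge0 ?(ltW q1) // mulr_ge0 ?(ltW C0) //; exact: bigmax_ge_id.
have lim (sj : nat * 'I_(N1 + N2)) : exists l, forall n,
    `|y n (sj.1%:Z - k%:Z) 0 sj.2 - l| <= B * q ^+ n.
  case: sj => s j; apply: geometric_limit => [//||n] /=.
    by rewrite (ltW q0) ltW.
  have -> : B * (q ^+ n - q ^+ n.+1) = C * q ^+ n * N0.
    by rewrite /B exprS; field; rewrite gt_eqF // subr_gt0.
  have := conv _ _ (soly 1%N) (soly 0%N) (s + n * omega)%N j.
  rewrite /y; have -> : (s + n * omega)%N%:Z - k%:Z + (1 * omega)%N%:Z
    = s%:Z - k%:Z + (n.+1 * omega)%N%:Z by lia.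
  have -> : (s + n * omega)%N%:Z - k%:Z + (0 * omega)%N%:Z
    = s%:Z - k%:Z + (n * omega)%N%:Z by lia.
  move=> /le_trans; apply; rewrite -/N0; apply: ler_wpM2r; first exact: bigmax_ge_id.
  apply: ler_wpM2l; first exact: ltW.
  rewrite exprD mulnC exprM; apply: ler_piMl; first exact/exprn_ge0/ltW.
  by rewrite exprn_ile1 ?ltW.
have [l lP] := choice lim.
pose zs : trajectory R N1 N2 := fun t => \row_j l (absz (t + k%:Z), j).
have yzs n t j : - k%:Z <= t -> `|y n t 0 j - zs t 0 j| <= B * q ^+ n.
  move=> kt; have := lP (absz (t + k%:Z), j) n; rewrite /zs mxE /=.
  by have -> : (absz (t + k%:Z))%:Z - k%:Z = t by lia.
have q01 : 0 < q < 1 by rewrite q0.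
exists zs; split.
  apply/is_solutionE => m; apply/rowP => j; apply/eqP; rewrite -subr_eq0; apply/eqP.
  apply: (geometric_bound_eq0 (B := B + B * (d j 0 - (P *m d) j 0)) q01) => n.
  rewrite -(subrKA (y n m.+1%:Z 0 j)) mulrDl; apply: le_trans (ler_normD _ _) _.
  apply: lerD; first by rewrite distrC; apply: yzs; lia.
  have /is_solutionE -> := soly n.
  rewrite mulrAC; apply: rhs_diff_le => t i /andP[mt _].
  apply: (@le_trans _ _ (B * q ^+ n)); first by apply: yzs; lia.
  by rewrite ler_peMr // mulr_ge0 // exprn_ge0 // ltW.
move=> t kt; apply/rowP => j; apply/eqP; rewrite -subr_eq0; apply/eqP.
apply: (geometric_bound_eq0 (B := B + B) q01) => n.
rewrite -(subrKA (y n (t + omega%:Z) 0 j)) mulrDl; apply: le_trans (ler_normD _ _) _.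
apply: lerD; first by rewrite distrC; apply: yzs; lia.
have -> : y n (t + omega%:Z) = y n.+1 t by rewrite /y; congr z; lia.
apply: le_trans (yzs _ _ _ kt) _; rewrite exprS; apply: ler_wpM2l => //.
by apply: ler_piMl; rewrite ?exprn_ge0 ?ltW.
Qed.

(** The gap between two periodic solutions at time [t] recurs at the times
    [t + n * omega], where it is geometrically small. *)
Lemma periodic_solution_unique (z z' : trajectory R N1 N2) :
  nonsingular_M_matrix P ->
  periodic_solution M omega z -> periodic_solution M omega z' ->
  same_trajectory M z z'.
Proof.
move=> PM [solz perz] [solz' perz'] t kt.
have [C [zeta [_ /andP[zeta0 zeta1] conv]]] := solutions_converge PM.
have per (y : trajectory R N1 N2) n :
    (forall t, - k%:Z <= t -> y (t + omega%:Z) = y t) ->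
    y (t + (n * omega)%N%:Z) = y t.
  move=> pery; elim: n => [|n <-]; first by rewrite mul0n addr0.
  by rewrite -[RHS]pery; [congr y; lia|lia].
apply/rowP => j; apply/eqP; rewrite -subr_eq0; apply/eqP.
pose s := absz (t + k%:Z).
apply: (@geometric_bound_eq0 _ (C * zeta ^+ s *
  norm_histories (segment M z 0 - segment M z' 0)) (zeta ^+ omega)) => [|n].
  by rewrite exprn_gt0 // exprn_ilt1 ?ltW // -lt0n.
have := conv _ _ solz solz' (s + n * omega)%N j.
have -> : (s + n * omega)%N%:Z - k%:Z = t + (n * omega)%N%:Z by rewrite /s; lia.
by rewrite !per // exprD mulnC exprM mulrA mulrAC.
Qed.

Lemma solution_stable (zs : trajectory R N1 N2) :
  nonsingular_M_matrix P -> is_solution M zs -> globally_exponentially_stable M zs.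
Proof.
move=> PM solzs; have [C [zeta [C0 zeta01 conv]]] := solutions_converge PM.
have /andP[zeta0 zeta1] := zeta01.
exists C, zeta; split=> //; split=> // alpha z solz <- m.
set N0 := norm_histories (segment M z 0 - _).
have N00 : 0 <= N0 by exact: bigmax_ge_id.
have zm0 : 0 <= zeta ^+ m by rewrite exprn_ge0 // ltW.
have rhs0 : 0 <= C * zeta ^+ m * N0 by rewrite mulr_ge0 // mulr_ge0 // ltW.
apply: bigmax_le => // i _; apply: bigmax_le => // p _; rewrite !ffunE.
have pk : (p <= k)%N by rewrite -ltnS.
have := conv _ _ solz solzs (m + (k - p))%N i.
have -> : (m + (k - p))%N%:Z - k%:Z = m%:Z - p%:Z by lia.
move=> /le_trans; apply; apply: ler_wpM2r => //; apply: ler_wpM2l; first exact: ltW.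
by apply: ler_wiXn2l; rewrite ?ltW ?leq_addr.
Qed.

End BamModel.

Theorem corollary4 (R : realType) (N1 N2 omega : nat) (M : bam R N1 N2)
  (F : 'I_N2 -> R) (G : 'I_N1 -> R)
  (hN1 : (0 < N1)%N) (hN2 : (0 < N2)%N) (homega : (0 < omega)%N)
  (hch : forall (i : 'I_N1) (m : nat), -1 < ch M i m < 1)
  (hct : forall (j : 'I_N2) (m : nat), -1 < ct M j m < 1)
  (hper : bam_periodic M omega)
  (hf : forall (j : 'I_N2) (u v : R), `|f M j u - f M j v| <= F j * `|u - v|)
  (hg : forall (i : 'I_N1) (u v : R), `|g M i u - g M i v| <= G i * `|u - v|)
  (hP : nonsingular_M_matrix (P_matrix M F G)) :
  exists zs : trajectory R N1 N2,
    periodic_solution M omega zs /\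
    (forall z : trajectory R N1 N2,
       periodic_solution M omega z -> same_trajectory M z zs) /\
    globally_exponentially_stable M zs.
Proof.
have [zs zsP] := periodic_solution_exists homega hper hf hg hP.
exists zs; split=> //; split=> [z zP|].
  exact: (periodic_solution_unique homega hper hf hg hP zP zsP).
by have [solzs _] := zsP; exact: (solution_stable homega hper hf hg hP solzs).
Qed.
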